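(* Let $G\subset \mathrm{O}_n(\mathbb{R})$ be a group, let $p\in\mathbb{R}[x_1,\dots,x_m]$ be a symmetric polynomial, and let $U$ be a real $m\times n$ matrix with nonzero rows $u_1,\dots,u_m$. Let $\mathcal{S}$ be the star transform with symbol $(p,U)$ and suppose that $\mathcal{S}$ is $G$-symmetric, i.e. for every $g\in G$ there is an $m\times m$ permutation matrix $\alpha_g$ with $Ug=\alpha_g U$. Then the symbol $p^*(U\xi)$ of the dual differential operator $\mathcal{L}$ of $\mathcal{S}$ belongs to the ring $\mathbb{R}[\xi_1,\dots,\xi_n]^G$ of $G$-invariant polynomials (that is, $p^*(Ug\xi)=p^*(U\xi)$ for all $g\in G$). In particular, $\mathcal{L}$ is $G$-invariant.
   Context: For $u\in\mathbb{R}^n\setminus\{0\}$, let $(\mathcal{X}_u f)(x)=\int_{-\infty}^{0} f(x+tu)\,dt$ and let $\mathcal{D}_u$ be the directional derivative along $u$. The star transform with symbol $(p,U)$ is the formal polynomial expression $\mathcal{S}=p(\mathcal{X}_{u_1},\dots,\mathcal{X}_{u_m})$ in the commuting operators $\mathcal{X}_{u_i}$, where $u_1,\dots,u_m$ are the rows of $U$ (the branch vectors). The reciprocal polynomial of $p$ is $p^*(x_1,\dots,x_m)=x_1^{d_1}\cdots x_m^{d_m}\,p(x_1^{-1},\dots,x_m^{-1})$, where $d_j$ is the degree of $p$ in $x_j$. The dual differential operator of $\mathcal{S}$ is $\mathcal{L}=p^*(\mathcal{D}_{u_1},\dots,\mathcal{D}_{u_m})$, the constant-coefficient differential operator with total symbol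 $p^*(U\xi)$, $\xi=(\xi_1,\dots,\xi_n)^T$. *)

(* Defs.v *)
From HB Require Import structures.
From mathcomp Require Import all_boot all_order all_algebra.
From mathcomp Require Import -(notations) mpoly.
From mathcomp Require Import all_classical all_reals all_analysis.

Set Implicit Arguments.
Unset Strict Implicit.
Unset Printing Implicit Defensive.

Import Order.TTheory GRing.Theory Num.Theory.
Import numFieldNormedType.Exports.

Local Open Scope classical_set_scope.
Local Open Scope ring_scope.

(* The notations of [mpoly] clash with those of MathComp-Analysis, so they are not
   imported; only this one is restored. *)
Notation "{ 'mpoly' R [ n ] }" := (mpoly n R) (at level 0, R, n at level 2).

Section Reciprocal.
Context {R : realType} {m : nat}.
Implicit Types (p : {mpoly R[m]}) (j : 'I_m).

Definition degree_in p j : nat :=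
  \max_(k <- msupp p) (k : multinom m) j.

Definition degrees p : multinom m := Multinom [tuple degree_in p j | j < m].

(* Each monomial x^k of p becomes x^d * x^(-k) = x^(d - k); the subtraction of
   exponents is exact because k <= d on the support of p. *)
Definition reciprocal p : {mpoly R[m]} :=
  \sum_(k <- msupp p) mcoeff k p *: mpolyX R (mnm_sub (degrees p) k).

Lemma meval_reciprocal p (x : 'I_m -> R) : (forall j, x j != 0) ->
  meval x (reciprocal p) =
  (\prod_j x j ^+ degree_in p j) * meval (fun j => (x j)^-1) p.
Proof.
move=> x0; rewrite /reciprocal raddf_sum /= mevalE mulr_sumr.
apply: eq_big_seq => k kp; rewrite mevalZ mevalX mulrCA.
congr (_ * _); rewrite -big_split /=; apply: eq_bigr => j _.
rewrite mnmBE /degrees /= /fun_of_multinom tnth_mktuple exprVn.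
rewrite expfB_cond //; last first.
  by rewrite (negbTE (x0 j)) add0n /degree_in (big_rem k) //= leq_maxl.
Qed.

End Reciprocal.

Section LinearSubstitution.
Context {R : realType}.

(* q(A xi), a polynomial in the entries xi_1, ..., xi_n of the column xi. *)
Definition lin_subst m n (A : 'M[R]_(m, n)) (q : {mpoly R[m]}) : {mpoly R[n]} :=
  comp_mpoly [tuple \sum_(j < n) A i j *: mpolyX R (mnm1 j) | i < m] q.

Lemma meval_lin_subst m n (A : 'M[R]_(m, n)) (q : {mpoly R[m]}) (xi : 'cV[R]_n) :
  meval (fun j => xi j 0) (lin_subst A q) =
  meval (fun i => (A *m xi) i 0) q.
Proof.
rewrite /lin_subst comp_mpoly_meval; apply: meval_eq => i.
rewrite tnth_mktuple raddf_sum mxE /=; apply: eq_bigr => j _.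
by rewrite mevalZ mevalXU.
Qed.

Definition invariant_poly n (G : set 'M[R]_n) (q : {mpoly R[n]}) : Prop :=
  forall g, G g -> lin_subst g q = q.

End LinearSubstitution.

(* A subgroup of O_n(R), not assumed to be finite or closed. *)
Definition orthogonal_group {R : realType} n (G : set 'M[R]_n) : Prop :=
  [/\ forall g, G g -> g *m g^T = 1%:M,
      G 1%:M,
      forall g h, G g -> G h -> G (g *m h) &
      forall g, G g -> G (invmx g)].

Section Operators.
Context {R : realType} {n : nat}.
Local Notation V := 'cV[R]_n.

(* p(A_1, ..., A_m) f for commuting operators A_i; the monomial with exponents
   k acts as A_1^(k_1) o ... o A_m^(k_m). *)
Definition poly_op m (p : {mpoly R[m]}) (A : 'I_m -> (V -> R) -> (V -> R))
    (f : V -> R) (x : V) : R :=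
  \sum_(k <- msupp p)
     mcoeff k p *
     foldr (fun i h => iter ((k : multinom m) i) (A i) h) f (enum 'I_m) x.

Definition beam (u : V) (f : V -> R) (x : V) : R :=
  \int[lebesgue_measure]_(t in `]-oo, 0%R]) f (x + t *: u).

Definition dirderiv (u : V) (f : V -> R) (x : V) : R := 'D_u f x.

(* C^oo: every iterated directional derivative of f is (Frechet)
   differentiable at every point. *)
Definition smooth (f : V -> R) : Prop :=
  forall (us : seq V) (x : V), differentiable (foldr dirderiv f us) x.

Definition invariant_op (G : set 'M[R]_n) (L : (V -> R) -> (V -> R)) : Prop :=
  forall g, G g -> forall f, smooth f ->
  forall x, L (fun y => f (g *m y)) x = L f (g *m x).

End Operators.

(* The star transform is a formal polynomial expression, hence it is given by
   its symbol (p, U); [star_op] is the operator that it denotes. *)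
Record star_transform (R : realType) (m n : nat) := StarTransform {
  star_poly : {mpoly R[m]};
  star_branches : 'M[R]_(m, n);
  star_branches_neq0 : forall i, row i star_branches != 0
}.

Section StarTransform.
Context {R : realType} {m n : nat}.
Implicit Types S : star_transform R m n.

Definition branch S (i : 'I_m) : 'cV[R]_n := (row i (star_branches S))^T.

Definition star_op S : ('cV[R]_n -> R) -> ('cV[R]_n -> R) :=
  poly_op (star_poly S) (fun i => beam (branch S i)).

Definition star_symmetric (G : set 'M[R]_n) S : Prop :=
  forall g, G g ->
  exists alpha : 'M[R]_m,
    is_perm_mx alpha /\ star_branches S *m g = alpha *m star_branches S.

Definition dual_op S : ('cV[R]_n -> R) -> ('cV[R]_n -> R) :=
  poly_op (reciprocal (star_poly S)) (fun i => dirderiv (branch S i)).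

Definition dual_symbol S : {mpoly R[n]} :=
  lin_subst (star_branches S) (reciprocal (star_poly S)).

End StarTransform.

(* Main.v *)
(** A permutation of the branches only permutes the variables of [p], so the
    reciprocal of a symmetric [p] is symmetric: its degrees in the single
    variables coincide. Hence [p*(U g xi) = p*(alpha_g U xi) = p*(U xi)].
    On functions, [D_u (f o g) = (D_(g u) f) o g], and [g] permutes the branch
    vectors because [g^T = g^-1] lies in [G]; since directional derivatives of a
    smooth function commute (Schwarz), [f |-> L f] commutes with [f |-> f o g]. *)

Require Import Defs.
From mathcomp Require Import all_boot all_order all_algebra.
From mathcomp Require Import -(notations) mpoly.
From mathcomp Require Import all_classical all_reals all_analysis.
From mathcomp Require Import perm ring.

Import Order.TTheory GRing.Theory Num.Theory.
Import numFieldNormedType.Exports.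

Local Open Scope ring_scope.

Section Symmetry.
Context {R : realType} {m : nat}.
Implicit Types (p : mpoly m R) (s : 'S_m).

(** Convertible to the action on exponents used by [msym_coeff], whose notation is not imported. *)
Definition mnm_perm s (k : multinom m) : multinom m :=
  Multinom [tuple (k : multinom m) (s i) | i < m].

Lemma mnm_permE s (k : multinom m) i : mnm_perm s k i = k (s i).
Proof. by rewrite /mnm_perm /fun_of_multinom tnth_mktuple. Qed.

Lemma mnm_permK s : cancel (mnm_perm s) (mnm_perm s^-1%g).
Proof. by move=> k; apply/mnmP => i; rewrite !mnm_permE permKV. Qed.

Lemma mcoeff_perm s p k : p \is mpoly.symmetric ->
  mcoeff (mnm_perm s k) p = mcoeff k p.
Proof. exact: msym_coeff. Qed.

(** The coefficients are constant on orbits of exponents. This reindexes sums and maxima over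
    [msupp p]. *)
Lemma perm_msupp_mnm_perm s p : p \is mpoly.symmetric ->
  perm_eq (msupp p) [seq mnm_perm s k | k <- msupp p].
Proof.
move=> sp; have sI := can_inj (mnm_permK s).
apply: uniq_perm; [exact: msupp_uniq|rewrite map_inj_uniq; [exact: msupp_uniq|exact: sI]|].
move=> k; have := mnm_permK s^-1%g k; rewrite invgK => <-.
by rewrite mem_map// !mcoeff_msupp mcoeff_perm.
Qed.

Lemma degree_in_perm s p j : p \is mpoly.symmetric ->
  degree_in p (s j) = degree_in p j.
Proof.
move=> sp; rewrite /degree_in [RHS](perm_big _ (perm_msupp_mnm_perm s _ sp)).
by rewrite [RHS]big_map; apply: eq_bigr => k _; rewrite mnm_permE.
Qed.

Lemma reciprocal_sym p : p \is mpoly.symmetric ->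
  reciprocal p \is mpoly.symmetric.
Proof.
move=> sp; apply/issymP => s; rewrite /reciprocal raddf_sum /=.
(* [msym s] moves exponents by the inverse of [s], so the right-hand sum is reindexed along that
   inverse. *)
rewrite [RHS](perm_big _ (perm_msupp_mnm_perm s^-1%g _ sp)) [RHS]big_map.
apply: eq_bigr => k _; rewrite msymZ msymX mcoeff_perm//; congr (_ *: mpolyX _ _).
apply/mnmP => i; rewrite -/(mnm_perm _ _) mnm_permE !mnmBE mnm_permE.
by rewrite /degrees /fun_of_multinom !tnth_mktuple degree_in_perm.
Qed.

End Symmetry.

Section LinearSubstitution.
Context {R : realType} {m n : nat}.

Lemma lin_substM l (A : 'M[R]_(m, n)) (B : 'M[R]_(n, l)) (q : mpoly m R) :
  lin_subst B (lin_subst A q) = lin_subst (A *m B) q.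
Proof.
rewrite /lin_subst [X in comp_mpoly _ X]comp_mpolyE raddf_sum /= [RHS]comp_mpolyE.
apply: eq_bigr => k _; rewrite comp_mpolyZ; congr (_ *: _).
rewrite rmorph_prod /=; apply: eq_bigr => i _.
rewrite rmorphXn /=; congr (_ ^+ _); rewrite !tnth_mktuple raddf_sum /=.
under eq_bigr do rewrite linearZ /= comp_mpolyXU -tnth_nth tnth_mktuple.
under eq_bigr do rewrite scaler_sumr.
rewrite exchange_big /=; apply: eq_bigr => j _.
rewrite mxE scaler_suml; apply: eq_bigr => k' _.
by rewrite scalerA.
Qed.

(** Row [i] of [perm_mx s *m U] is row [s i] of [U]: permuting the substituted linear forms amounts
    to permuting the variables of [q]. *)
Lemma lin_subst_perm_mx (s : 'S_m) (U : 'M[R]_(m, n)) (q : mpoly m R) :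
  lin_subst (perm_mx s *m U) q = lin_subst U (msym s q).
Proof.
rewrite /lin_subst msym_mPo; congr comp_mpoly; apply: eq_mktuple => i.
by rewrite tnth_mktuple -row_permE; apply: eq_bigr => j _; rewrite mxE.
Qed.

End LinearSubstitution.

Section Schwarz.
Context {R : realType} {V : normedModType R}.
Implicit Types (f : V -> R) (a u v x : V).

Lemma is_derive_line f a u (s : R) : derivable f (a + s *: u) u ->
  is_derive s 1 (fun t : R => f (a + t *: u)) ('D_u f (a + s *: u)).
Proof.
have E : (fun h : R => h^-1 *: (((fun t : R => f (a + t *: u)) \o shift s) (h *: 1)
             - f (a + s *: u))) =
         (fun h : R => h^-1 *: ((f \o shift (a + s *: u)) (h *: u)
             - f (a + s *: u))).
  by apply/funext => h; rewrite /= -[h%:A]/(h * 1) mulr1 scalerDl addrCA.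
move=> df; split; first by rewrite /derivable E.
by rewrite /derive E.
Qed.

(* The mean value theorem, first along [u] for the increment of [f] in the
   direction [v], then along [v] for ['D_u f]. *)
Lemma second_difference f u v x (h : R) : 0 < h ->
  (forall y, derivable f y u) -> (forall y, derivable ('D_u f) y v) ->
  exists s t : R, [/\ 0 < s < h, 0 < t < h &
    f (x + h *: v + h *: u) - f (x + h *: u) - (f (x + h *: v) - f x) =
    ('D_v ('D_u f) (x + s *: u + t *: v) : R) * (h * h)].
Proof.
move=> h0 fu fuv.
pose phi (s : R) : R := f (x + h *: v + s *: u) - f (x + s *: u).
pose dphi (s : R) : R := 'D_u f (x + h *: v + s *: u) - 'D_u f (x + s *: u).
have dphiE (s : R) : is_derive s 1 phi (dphi s).
  by apply: is_deriveB; apply: is_derive_line.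
have [|s /[!in_itv]/= s0h Es] := @MVT R phi dphi 0 h h0.
  by apply: derivable_within_continuous => s _.
pose psi (t : R) : R := 'D_u f (x + s *: u + t *: v).
pose dpsi (t : R) : R := 'D_v ('D_u f) (x + s *: u + t *: v).
have dpsiE (t : R) : is_derive t 1 psi (dpsi t) by apply: is_derive_line.
have [|t /[!in_itv]/= t0h Et] := @MVT R psi dpsi 0 h h0.
  by apply: derivable_within_continuous => t _.
exists s, t; split => //; move: Et; rewrite subr0 mulrA -/(dpsi t) => <-.
have -> : psi h - psi 0 = dphi s by rewrite /psi /dphi scale0r addr0 addrAC.
move: Es; rewrite subr0 => <-.
by rewrite /phi !scale0r !addr0; ring.
Qed.

(** The second difference is symmetric in [u] and [v], so the two mixed derivatives share a value at
    points arbitrarily close to [x]; continuity at [x] concludes. *)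
Lemma derive_comm f u v x :
  (forall y, derivable f y u) -> (forall y, derivable f y v) ->
  (forall y, derivable ('D_u f) y v) -> (forall y, derivable ('D_v f) y u) ->
  {for x, continuous ('D_v ('D_u f))} -> {for x, continuous ('D_u ('D_v f))} ->
  'D_v ('D_u f) x = 'D_u ('D_v f) x.
Proof.
move=> fu fv fuv fvu cuv cvu.
pose F y : R := 'D_v ('D_u f) y; pose H y : R := 'D_u ('D_v f) y.
suff dFH (e : R) : 0 < e -> `|F x - H x| <= e + e.
  apply/eqP; rewrite -subr_eq0 -normr_le0; apply/ler_addgt0Pr => e e0.
  by rewrite add0r [e]splitr dFH// divr_gt0.
move=> e0.
have [d d0 Hd] : exists2 d : R, 0 < d & forall y, `|x - y| < d ->
    `|F x - F y| < e /\ `|H x - H y| < e.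
  move: cuv cvu => /cvgrPdist_lt/(_ e e0) cuv /cvgrPdist_lt/(_ e e0) cvu.
  by apply/nbhs_normP; exact: filterI cuv cvu.
(* The summand 1 keeps [M] positive when [u] and [v] vanish, and makes the bound [h * M = d] on the
   displacements strict. *)
pose M := `|u| + `|v| + 1.
have M0 : 0 < M by rewrite ltr_wpDl ?addr_ge0.
pose h := d / M.
have h0 : 0 < h by rewrite divr_gt0.
have near_x w1 w2 (s t : R) : 0 < s < h -> 0 < t < h ->
    `|w1| + `|w2| + 1 = M -> `|x - (x + s *: w1 + t *: w2)| < d.
  move=> /andP[s0 sh] /andP[t0 th] ME; rewrite -addrA opprD addNKr normrN.
  have -> : d = h * (`|w1| + `|w2| + 1) by rewrite ME /h divfK ?gt_eqF.
  rewrite (le_lt_trans (ler_normD _ _))// !normrZ !gtr0_norm// 2!mulrDr mulr1.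
  by rewrite ltr_pwDr// lerD// ler_wpM2r// ltW.
have [s [t [sh th Euv]]] := second_difference f u v x h h0 fu fuv.
have [s' [t' [sh' th' Evu]]] := second_difference f v u x h h0 fv fvu.
have [Huv _] := Hd _ (near_x u v s t sh th erefl).
have [_ Hvu] := Hd _ (near_x v u s' t' sh' th' (congr1 (+%R^~ 1) (addrC _ _))).
(* Both sides times [h * h] are the same second difference, up to the order of its terms. *)
have E : H (x + s' *: v + t' *: u) = F (x + s *: u + t *: v).
  have hh0 : h * h != 0 by rewrite mulf_neq0 ?gt_eqF.
  rewrite -/(F _) in Euv; rewrite -/(H _) in Evu.
  apply: (mulIf hh0).
  apply: etrans (esym Evu) (etrans _ Euv).
  rewrite (addrAC x) !opprB [LHS]addrACA [RHS]addrACA.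
  by rewrite [- f _ + - f _ in LHS]addrC.
rewrite E in Hvu.
apply: le_trans (ler_distD (F (x + s *: u + t *: v)) _ _) _.
by apply: lerD; [exact: ltW Huv | rewrite distrC; exact: ltW Hvu].
Qed.

End Schwarz.

Section SmoothFunctions.
Context {R : realType} {n : nat}.
Local Notation V := 'cV[R]_n.
Implicit Types (f : V -> R) (us vs : seq V).

Lemma smooth_foldr f us : smooth f -> smooth (foldr dirderiv f us).
Proof. by move=> sf vs x; rewrite -foldr_cat; exact: sf. Qed.

Lemma smooth_dirderivC f (u v : V) : smooth f ->
  dirderiv v (dirderiv u f) = dirderiv u (dirderiv v f).
Proof.
move=> sf; apply/funext => x; apply: derive_comm => [y|y|y|y||].
- exact/diff_derivable/(sf [::]).
- exact/diff_derivable/(sf [::]).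
- exact/diff_derivable/(sf [:: u]).
- exact/diff_derivable/(sf [:: v]).
- exact/differentiable_continuous/(sf [:: v; u]).
- exact/differentiable_continuous/(sf [:: u; v]).
Qed.

Lemma foldr_dirderiv_perm f us vs : smooth f -> perm_eq us vs ->
  foldr dirderiv f us = foldr dirderiv f vs.
Proof.
move=> sf; elim: us vs => [|u us IH] vs; first by rewrite perm_sym => /perm_nilP ->.
move=> uvs; have /splitPr vsE : u \in vs by rewrite -(perm_mem uvs) mem_head.
(* The head [u] is cut out of [vs], then carried past [v1] one derivative at a time. *)
case: vsE uvs => v1 v2; rewrite perm_sym -cat1s perm_catCA /= perm_cons perm_sym.
move=> /IH ->; elim: v1 => //= v v1 <-.
by rewrite -smooth_dirderivC//; exact: smooth_foldr.
Qed.

(** By linearity of [g], the difference quotient of [f o g] at [y] along [u] is that of [f] at [g y]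
    along [g u]. *)
Lemma foldr_dirderiv_mulmx (g : 'M[R]_n) f us :
  foldr dirderiv (fun y => f (g *m y)) us =
  (fun y => foldr dirderiv f [seq g *m u | u <- us] (g *m y)).
Proof.
elim: us => //= u us ->; apply/funext => y; rewrite /dirderiv /derive.
congr lim; apply: (congr1 (fun F => fmap F _)); apply/funext => h /=.
by rewrite mulmxDr -scalemxAr.
Qed.

(** Spells a monomial of [poly_op] as a single word of directions, the form that
    [foldr_dirderiv_perm] can rearrange. *)
Lemma foldr_iter_dirderiv (I : Type) (k : I -> nat) (b : I -> V) f (s : seq I) :
  foldr (fun i h => iter (k i) (dirderiv (b i)) h) f s =
  foldr dirderiv f (flatten [seq nseq (k i) (b i) | i <- s]).
Proof.
elim: s => //= i s ->; rewrite foldr_cat.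
by elim: (k i) => //= l ->.
Qed.

Lemma poly_op_dirderiv_mulmx m (q : mpoly m R) (b : 'I_m -> V) (g : 'M[R]_n)
    (s : 'S_m) f x :
  q \is mpoly.symmetric -> (forall i, g *m b i = b (s i)) -> smooth f ->
  poly_op q (fun i => dirderiv (b i)) (fun y => f (g *m y)) x =
  poly_op q (fun i => dirderiv (b i)) f (g *m x).
Proof.
move=> sq gb sf; rewrite /poly_op.
rewrite [RHS](perm_big _ (perm_msupp_mnm_perm s^-1%g _ sq)) [RHS]big_map.
apply: eq_bigr => k _; rewrite mcoeff_perm//; congr (_ * _).
rewrite !foldr_iter_dirderiv foldr_dirderiv_mulmx map_flatten -map_comp.
congr (_ _); apply: foldr_dirderiv_perm => //; apply: perm_flatten.
have sE : perm_eq [seq s i | i <- enum 'I_m] (enum 'I_m).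
  apply: uniq_perm; [|exact: enum_uniq|move=> i].
    by rewrite map_inj_uniq ?enum_uniq//; exact: perm_inj.
  by rewrite -[i](permKV s) mem_map ?mem_enum//; exact: perm_inj.
(* Visited in the order [s i], the blocks of the right-hand word are [k i] copies of [b (s i)], that
   is, of [g *m b i]. *)
apply: etrans _ (perm_map (fun i => nseq (mnm_perm s^-1%g k i) (b i)) sE).
congr (perm_eq _ _); rewrite -[RHS]map_comp; apply: eq_map => i /=.
by rewrite map_nseq gb mnm_permE permK.
Qed.

End SmoothFunctions.

Theorem theorem3p2 (R : realType) (m n : nat) (G : set 'M[R]_n)
    (S : star_transform R m n)
    (hG : orthogonal_group G)
    (hp : star_poly S \is mpoly.symmetric)
    (hS : star_symmetric G S) :
  [/\ invariant_poly G (dual_symbol S),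
      (forall g, G g ->
         lin_subst (star_branches S *m g) (reciprocal (star_poly S)) =
         lin_subst (star_branches S) (reciprocal (star_poly S))) &
      invariant_op G (dual_op S)].
Proof.
have sp := reciprocal_sym _ hp.
have symbolE g : G g ->
    lin_subst (star_branches S *m g) (reciprocal (star_poly S)) =
    lin_subst (star_branches S) (reciprocal (star_poly S)).
  move=> /hS[_ [/is_perm_mxP[s ->] ->]].
  by rewrite lin_subst_perm_mx (issymP _ sp).
split => // [g Gg|g Gg f sf x]; first by rewrite /dual_symbol lin_substM symbolE.
have [orthG _ _ invG] := hG.
(* Symmetry is used at the inverse of [g]: branches are columns, and [g *m u] is the transpose of
   [u^T *m g^T] with [g^T = invmx g]. *)
have [_ [/is_perm_mxP[s ->] Us]] := hS _ (invG g Gg).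
apply: (poly_op_dirderiv_mulmx _ _ _ _ s) => // i.
have gT : g^T = invmx g.
  have gu : g \in unitmx by have /mulmx1_unit[] := orthG g Gg.
  by rewrite -[LHS](mulKmx gu) orthG// mulmx1.
rewrite /branch -[g in LHS]trmxK -trmx_mul gT -row_mul Us.
by rewrite -row_permE; congr trmx; apply/rowP => j; rewrite !mxE.
Qed.
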